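(* Let $G$ be a connected compact group and let $L$ and $K$ be finite-dimensional continuous real $G$-representations, each endowed with a $G$-invariant inner product. Then every $G$-equivariant piecewise linear map $F\colon L\to K$ has a unique expression \[ F(v+w)=\psi(v)+A(w),\qquad v\in L^G,\quad w\in (L^G)^\perp, \] where $A\in\operatorname{Hom}_G\bigl((L^G)^\perp,(K^G)^\perp\bigr)$ and $\psi\colon L^G\to K^G$ is a piecewise linear map; moreover $\psi$ is arbitrary, i.e. every pair $(\psi,A)$ consisting of a piecewise linear map $\psi\colon L^G\to K^G$ and $A\in\operatorname{Hom}_G\bigl((L^G)^\perp,(K^G)^\perp\bigr)$ arises in this way from a $G$-equivariant piecewise linear map $F\colon L\to K$. In particular, if $L$ and $K$ are irreducible and $L$ is non-trivial, then every $G$-equivariant piecewise linear map $L\to K$ is affine linear, and \[ \operatorname{Hom}^{\mathrm{pl}}_G(L,K)\neq 0 \quad\Longleftrightarrow\quad L\cong K\ \text{ or }\ K\cong\mathbb{R}_{\mathrm{triv}}. \] If $L$ and $K$ are irreducible and both non-trivial, this reduces to \[ \operatorname{Hom}^{\mathrm{pl}}_G(L,K)\neq 0 \quad\Longleftrightarrow\quad L\cong K. \]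
   Context: A representation of $G$ on a finite-dimensional real vector space $L$ is a continuous group homomorphism $\rho_L\colon G\to \operatorname{GL}(L)$. It is irreducible if its only $G$-invariant linear subspaces are $\{0\}$ and $L$, and non-trivial if $\rho_L(g)\neq \mathrm{id}_L$ for some $g\in G$. $L\cong K$ means that there is a $G$-equivariant linear isomorphism $L\to K$. $\mathbb{R}_{\mathrm{triv}}$ is the one-dimensional real representation on which every $g\in G$ acts as the identity. $L^G:=\{v\in L:\rho_L(g)v=v\text{ for all }g\in G\}$. A map $\Phi\colon L\to K$ is $G$-equivariant if $\rho_K(g)\Phi(l)=\Phi(\rho_L(g)l)$ for all $g\in G$, $l\in L$. $\operatorname{Hom}_G(L,K)$ is the vector space of $G$-equivariant linear maps $L\to K$. A map $f\colon V\to W$ of finite-dimensional real vector spaces is affine linear if $f(x)=M(x)+b$ for some linear $M\colon V\to W$ and $b\in W$. A convex polyhedral subset of $V$ is an intersection of finitely many closed affine half-spaces (possibly none). A map $f\colon V\to W$ is piecewise linear if there are finitely many convex polyhedral subsets $A_1,\dots,A_m$ with $V=\bigcup_i A_i$ such that for every $i$ there are a linear map $M_i\colon V\to W$ and $b_i\in W$ with $f(x)=M_i(x)+b_i$ for all $x\in A_i$. $\operatorname{Hom}^{\mathrm{pl}}_G(L,K)$ is the vector space of $G$-equivariant piecewise linear maps $L\to K$. *)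

(* Defs.v *)
From HB Require Import structures.
From mathcomp Require Import all_boot all_order all_algebra.
From mathcomp Require Import all_classical all_reals all_analysis.

Set Implicit Arguments.
Unset Strict Implicit.
Unset Printing Implicit Defensive.

Import Order.TTheory GRing.Theory Num.Theory.
Import numFieldNormedType.Exports.

Local Open Scope classical_set_scope.
Local Open Scope ring_scope.

HB.mixin Record isTopologicalGroup (G : Type) of Group G & Topological G := {
  mulg_continuous : continuous (fun x : G * G => (x.1 * x.2)%g) ;
  invg_continuous : continuous (fun x : G => (x^-1)%g)
}.

#[short(type="topologicalGroupType")]
HB.structure Definition TopologicalGroup :=
  {G of isTopologicalGroup G & Group G & Topological G}.

Section PiecewiseLinear.
Variables (R : realType) (V W : vectType R).

Definition closed_half_space (H : set V) : Prop :=
  exists (phi : 'Hom(V, R^o)) (c : R), phi != 0 /\ H = [set x | phi x <= c].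

Definition convex_polyhedral (A : set V) : Prop :=
  exists (n : nat) (H : 'I_n -> set V),
    (forall i, closed_half_space (H i)) /\ A = \bigcap_i H i.

Definition affine_linear (f : V -> W) : Prop :=
  exists (M : 'Hom(V, W)) (b : W), forall x, f x = M x + b.

Definition piecewise_linear (f : V -> W) : Prop :=
  exists (m : nat) (A : 'I_m -> set V),
    [/\ forall i, convex_polyhedral (A i),
        \bigcup_i A i = setT &
        forall i, exists (M : 'Hom(V, W)) (b : W),
          forall x, A i x -> f x = M x + b].

End PiecewiseLinear.

Section Representations.
Variables (R : realType) (G : topologicalGroupType).

(* The first two conditions make every [rho g] invertible.  The topology of
   GL(L) is that of matrices with respect to a basis of L (all bases induce
   the same topology). *)
Definition representation (L : vectType R) (rho : G -> 'End(L)) : Prop :=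
  [/\ rho 1%g = \1%VF,
      forall g h, rho (g * h)%g = (rho g \o rho h)%VF &
      continuous (fun g => passmx.mxof (vbasis {:L}) (vbasis {:L}) (rho g))].

Definition invariant_form (L : vectType R) (rho : G -> 'End(L))
    (form : L -> L -> R) : Prop :=
  forall g v w, form (rho g v) (rho g w) = form v w.

Definition invariant_subspace (L : vectType R) (rho : G -> 'End(L))
    (U : {vspace L}) : Prop :=
  forall g, (rho g @: U <= U)%VS.

(* The zero representation is irreducible in this sense. *)
Definition irreducible (L : vectType R) (rho : G -> 'End(L)) : Prop :=
  forall U : {vspace L}, invariant_subspace rho U -> U = 0%VS \/ U = fullv.

Definition nontrivial (L : vectType R) (rho : G -> 'End(L)) : Prop :=
  exists g, rho g <> \1%VF.

Definition trivial_repr (g : G) : 'End(R^o) := \1%VF.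

Definition equivariant (L K : vectType R) (rhoL : G -> 'End(L))
    (rhoK : G -> 'End(K)) (Phi : L -> K) : Prop :=
  forall g l, rhoK g (Phi l) = Phi (rhoL g l).

Definition HomG (L K : vectType R) (rhoL : G -> 'End(L))
    (rhoK : G -> 'End(K)) : set 'Hom(L, K) :=
  [set A | equivariant rhoL rhoK A].

Definition HomGpl (L K : vectType R) (rhoL : G -> 'End(L))
    (rhoK : G -> 'End(K)) : set (L -> K) :=
  [set F | equivariant rhoL rhoK F /\ piecewise_linear F].

Definition isomorphic (L K : vectType R) (rhoL : G -> 'End(L))
    (rhoK : G -> 'End(K)) : Prop :=
  exists2 A : 'Hom(L, K), HomG rhoL rhoK A & bijective A.

(* The unique subspace with the right elements; see [mem_fixed_space]. *)
Definition fixed_space (L : vectType R) (rho : G -> 'End(L)) : {vspace L} :=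
  xget 0%VS [set U : {vspace L} | forall v, v \in U <-> forall g, rho g v = v].

(* Meaningful when U is invariant; see [subreprE]. *)
Definition subrepr (L : vectType R) (rho : G -> 'End(L)) (U : {vspace L})
    (g : G) : 'End(subvs_of U) :=
  linfun (vsproj U \o rho g \o vsval).

End Representations.

Section Facts.
Variables (R : realType) (G : topologicalGroupType) (L : vectType R).
Implicit Types (rho : G -> 'End(L)) (U : {vspace L}).

Lemma mem_fixed_space rho v :
  v \in fixed_space rho <-> forall g, rho g v = v.
Proof.
rewrite /fixed_space; case: xgetP => [U _ ->//|noU].
pose P (U : {vspace L}) := {in U, forall u g, rho g u = u}.
pose Q n := `[< exists2 U, P U & \dim U = n >].
have Q0 : exists n, Q n.
  exists 0%N; apply/asboolP; exists 0%VS; last by rewrite dimv0.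
  by move=> u; rewrite memv0 => /eqP -> g; rewrite linear0.
have Qle n : Q n -> (n <= \dim {:L})%N.
  by move=> /asboolP[U _ <-]; exact/dimvS/subvf.
case: (ex_maxnP Q0 Qle) => n /asboolP[U PU dU] maxn.
exfalso; apply: (noU U) => u; split=> [uU g|uP]; first exact: PU.
have PUu : P (U + <[u]>)%VS.
  move=> _ /memv_addP[x xU [y /vlineP[k ->] ->]] g.
  by rewrite linearD linearZ /= uP PU.
have : Q (\dim (U + <[u]>)%VS) by apply/asboolP; exists (U + <[u]>)%VS.
move=> /maxn; rewrite -dU => le.
have /eqP -> : U == (U + <[u]>)%VS by rewrite eqEdim addvSl.
by rewrite memvE addvSr.
Qed.

Lemma subreprE rho U : invariant_subspace rho U ->
  forall g w, vsval (subrepr rho U g w) = rho g (vsval w).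
Proof.
move=> inv g w; rewrite lfunE /= vsprojK//.
by have /subvP := inv g; apply; apply/memv_img/subvsP.
Qed.

Lemma invariant_fixed_space rho : invariant_subspace rho (fixed_space rho).
Proof.
by move=> g; apply/subvP => _ /memv_imgP[u uU ->]; rewrite (mem_fixed_space rho u).1.
Qed.

Lemma invariant_orthov rho (dot : {dot L for @idfun R}) U :
    representation rho -> invariant_form rho dot -> invariant_subspace rho U ->
  invariant_subspace rho (orthov dot U).
Proof.
move=> [rho1 rhoM _] invd invU g; apply/subvP => _ /memv_imgP[u uU ->].
apply/mem_orthovP => v vU; have /= <- := invd g^-1%g (rho g u) v.
rewrite -comp_lfunE -rhoM mulVg rho1 id_lfunE.
move/mem_orthovP: uU; apply.
by have /subvP := invU g^-1%g; apply; apply/memv_img.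
Qed.

Lemma representation_subrepr rho U :
    representation rho -> invariant_subspace rho U ->
  representation (subrepr rho U).
Proof.
move=> [rho1 rhoM rhoC] inv; split.
- by apply/lfunP => w; apply/val_inj; rewrite /= subreprE// rho1 !id_lfunE.
- move=> g h; apply/lfunP => w; apply/val_inj.
  by rewrite comp_lfunE /= !subreprE// rhoM comp_lfunE.
pose e := vbasis {:L}; pose f := vbasis {:subvs_of U}.
pose P := passmx.mxof f e (linfun (vsval : subvs_of U -> L)).
pose Q := passmx.mxof e f (linfun (vsproj U)).
have -> : (fun g => passmx.mxof f f (subrepr rho U g)) =
          (fun g => P *m passmx.mxof e e (rho g) *m Q).
  apply/funext => g; rewrite /P /Q.
  rewrite -!passmx.mxof_comp ?vbasisP//; congr passmx.mxof; apply/lfunP => w.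
  by rewrite !comp_lfunE !lfunE.
have rhoij i j : continuous (fun g => passmx.mxof e e (rho g) i j).
  move=> g; apply: (@continuous_comp _ _ _
      (fun g => passmx.mxof e e (rho g)) (fun M => M i j)); first exact: rhoC.
  exact: coord_continuous.
move=> g A [B nB sBA].
apply: (@filterS _ _ _ [set h | forall i j,
  B i j ((P *m passmx.mxof e e (rho h) *m Q) i j)]); first by move=> h; apply: sBA.
apply: filter_forall => i; apply: filter_forall => j.
suff: continuous (fun h => (P *m passmx.mxof e e (rho h) *m Q) i j).
  by move=> /(_ g); apply; exact: nB.
have -> : (fun h => (P *m passmx.mxof e e (rho h) *m Q) i j) =
  (fun h => \sum_k (\sum_l P i l * passmx.mxof e e (rho h) l k) * Q k j).
  by apply/funext => h; rewrite mxE; apply: eq_bigr => k _; rewrite mxE.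
apply: continuous_big => [|k _]; first exact: add_continuous.
move=> h; apply: cvgM; last exact: cvg_cst.
move: h; apply: continuous_big => [|l _]; first exact: add_continuous.
by move=> h; apply: cvgM; [exact: cvg_cst|exact: rhoij].
Qed.

End Facts.

(* Main.v *)
Require Import Defs.
From HB Require Import structures.
From mathcomp Require Import all_boot all_order all_algebra.
From mathcomp Require Import all_classical all_reals all_analysis.

Set Implicit Arguments.
Unset Strict Implicit.
Unset Printing Implicit Defensive.

Import Order.TTheory GRing.Theory Num.Theory.
Import numFieldNormedType.Exports.

Local Open Scope classical_set_scope.
Local Open Scope ring_scope.

(** Call a set thin if it lies in a proper subset [C] of the space such that
    every line is contained in [C] or meets it in finitely many points; finite
    unions of proper affine subspaces are thin, and the whole space is not.  An
    affine piece of an equivariant piecewise linear map [F] that agrees with [F]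
    on a non-thin set is carried by [g] to another one.  There are finitely many
    of them and [G] is connected, so each of them is equivariant, and by
    continuity [F x] is always the value at [x] of some equivariant affine map
    [M_i x + b_i].

    For [v] fixed, [k] fixed and [w] orthogonal to the fixed vectors, the number
    [<F (v + t w), k>] takes finitely many values, so it does not depend on [t],
    and therefore [F (v + w) - F v] is one of the [M_i w].  If [M_i] and [M_j]
    differ on the orthogonal complement of the fixed vectors, their difference
    has rank at least two there, since a [G]-stable line is fixed pointwise.
    So the coincidence sets have codimension at least two, their complement is
    connected, and one index [i] serves for all [v + w]. *)

(** * Finite closed covers and the real line *)

(** By [eqB] two of the sets are equal or disjoint, so the complement of [B i] is a finite union of
    closed sets and [B i] is clopen. *)
Lemma connected_finite_cover (T : topologicalType) (I : finType)
    (B : I -> set T) :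
  connected [set: T] -> (forall i, closed (B i)) ->
  (forall t, exists i, B i t) ->
  (forall i j t, B i t -> B j t -> B i = B j) ->
  forall i, B i !=set0 -> B i = setT.
Proof.
move=> conT clB covB eqB i Bi0; apply: conT => //; last first.
  by exists (B i) => //; rewrite setTI.
exists (B i); last by rewrite setTI.
have -> : B i = ~` (\bigcup_(j in [set j | B j <> B i]) B j).
  apply/seteqP; split=> [t Bit [j /= neq Bjt]|t noB].
    exact/neq/(eqB _ _ t).
  have [j Bjt] := covB t; have [<-//|neq] := pselect (B j = B i).
  by case: noB; exists j.
by apply: closed_openC; apply: closed_bigcup => //; exact: finite_finset.
Qed.

(** Pasting: a closed [B i] missing [t] misses a neighbourhood of [t], so near [t] only the pieces
    through [t] matter. *)
Lemma continuous_finite_closed_cover (T U : topologicalType) (I : finType)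
    (B : I -> set T) (f : T -> U) (g : I -> T -> U) :
  (forall i, closed (B i)) -> (forall t, exists i, B i t) ->
  (forall i, continuous (g i)) -> (forall i t, B i t -> f t = g i t) ->
  continuous f.
Proof.
move=> clB covB cg fg t A fA.
have near_i i : \forall s \near t, B i s -> A (f s).
  have [Bit|nBit] := pselect (B i t).
    have : \forall s \near t, A (g i s) by apply: cg; rewrite -(fg _ _ Bit).
    by apply: filterS => s Ags Bis; rewrite (fg _ _ Bis).
  have : \forall s \near t, (~` B i) s.
    by apply: open_nbhs_nbhs; split => //; exact: closed_openC.
  by apply: filterS.
have : \forall s \near t, forall i, B i s -> A (f s) by exact: filter_forall.
by apply: filterS => s As; have [i Bis] := covB s; exact: As Bis.
Qed.

Lemma connected_setT (R : realType) : connected [set: R].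
Proof. by apply/connected_intervalP => x y z. Qed.

Lemma infinite_real (R : realType) : infinite_set [set: R].
Proof.
move=> finR; apply: infinite_nat.
have : finite_set (((fun n : nat => n%:R : R) @^-1` setT) : set nat).
  by apply: finite_preimage => // m n _ _ /eqP; rewrite eqr_nat => /eqP.
by rewrite preimage_setT.
Qed.

(** Finite sets of reals are closed, so [S] is clopen; it is nonempty since [R] is infinite. *)
Lemma cofinite_closed_real (R : realType) (S : set R) :
  closed S -> finite_set (~` S) -> S = setT.
Proof.
move=> clS finS.
have clCS : closed (~` S).
  have accR : accessible_space R by exact/hausdorff_accessible/norm_hausdorff.
  exact: (iffLR accessible_finite_set_closed accR _ finS).
have S0 : S !=set0.
  apply/set0P/eqP => S0; apply: (@infinite_real R).
  by rewrite -setC0 -S0.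
apply: (@connected_setT R) => //; exists S; rewrite ?setTI//.
by rewrite -[S]setCK; exact: closed_openC.
Qed.

(** * Continuity tested by linear functionals *)

Section WeakContinuity.
Variables (R : realType) (T : topologicalType).

(* Continuity for the topology of [W] as a finite-dimensional vector space;
   [vectType] carries no topology of its own. *)
Definition wcontinuous (W : vectType R) (f : T -> W) :=
  forall phi : 'Hom(W, R^o), continuous (fun t => phi (f t) : R).

Lemma wcontinuous_cst (W : vectType R) (w : W) : wcontinuous (fun=> w).
Proof. by move=> phi t; exact: cvg_cst. Qed.

Lemma wcontinuousD (W : vectType R) (f g : T -> W) :
  wcontinuous f -> wcontinuous g -> wcontinuous (fun t => f t + g t).
Proof.
move=> cf cg phi.
have -> : (fun t => phi (f t + g t) : R) = (fun t => phi (f t) + phi (g t)).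
  by apply/funext => t; rewrite linearD.
by move=> t; apply: cvgD; [exact: cf|exact: cg].
Qed.

Lemma wcontinuous_lfun (V W : vectType R) (A : 'Hom(V, W)) (f : T -> V) :
  wcontinuous f -> wcontinuous (fun t => A (f t)).
Proof.
move=> cf phi; have := cf (phi \o A)%VF.
by under eq_fun do rewrite comp_lfunE.
Qed.

Lemma hom_separated (W : vectType R) (u v : W) :
  (forall phi : 'Hom(W, R^o), phi u = phi v) -> u = v.
Proof.
move=> euv; rewrite (coord_vbasis (memvf u)) (coord_vbasis (memvf v)).
apply: eq_bigr => i _; congr (_ *: _).
pose c : {linear W -> R^o} := coord (vbasis {:W}) i.
by have := euv (linfun c); rewrite !lfunE.
Qed.

Lemma wcontinuous_closed_eq (W : vectType R) (f g : T -> W) :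
  wcontinuous f -> wcontinuous g -> closed [set t | f t = g t].
Proof.
move=> cf cg.
have -> : [set t | f t = g t] = \bigcap_(phi : 'Hom(W, R^o))
    ((fun t => phi (f t) - phi (g t) : R) @^-1` [set x | x = 0]).
  apply/seteqP; split=> [t /= fgt phi _ /=|t eq_t]; first by rewrite fgt subrr.
  by apply: hom_separated => phi; apply/eqP; rewrite -subr_eq0; apply/eqP/eq_t.
apply: closed_bigI => phi _; apply: preimage_closed; last exact: closed_eq.
by move=> t _; apply: cvgB; [exact: cf|exact: cg].
Qed.

Lemma wcontinuous_finite_closed_cover (W : vectType R) (I : finType)
    (B : I -> set T) (f : T -> W) (g : I -> T -> W) :
  (forall i, closed (B i)) -> (forall t, exists i, B i t) ->
  (forall i, wcontinuous (g i)) -> (forall i t, B i t -> f t = g i t) ->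
  wcontinuous f.
Proof.
move=> clB covB cg fg phi.
apply: (@continuous_finite_closed_cover _ _ _ B _
  (fun i t => phi (g i t))) => //.
  by move=> i; exact: cg.
by move=> i t /fg ->.
Qed.

End WeakContinuity.

(** * Thin sets, the negligible sets of the argument *)

Section ThinSets.
Variables (R : realType) (V : vectType R).
Implicit Types (C S : set V) (x d : V).

Definition line_closed C := forall x d,
  (forall t : R, C (x + t *: d)) \/ finite_set [set t : R | C (x + t *: d)].

Definition thin S :=
  exists C, [/\ S `<=` C, exists x, ~ C x & line_closed C].

Lemma thin_sub S S' : S `<=` S' -> thin S' -> thin S.
Proof.
by move=> sSS' [C [sC]]; exists C; split=> //; exact: subset_trans sC.
Qed.

Lemma thin0 : thin set0.
Proof.
by exists set0; split=> //; [exists 0|move=> x d; right; exact: finite_set0].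
Qed.

Lemma line_closed_finite C x z : line_closed C -> ~ C z ->
  finite_set [set t : R | C (x + t *: (z - x))].
Proof.
by move=> lC nCz; case: (lC x (z - x)) => // /(_ 1); rewrite scale1r subrKC.
Qed.

(** The line through [x] outside [C] and [x'] outside [C'] meets each of the two sets finitely
    often, so some point of it avoids both. *)
Lemma thinU S S' : thin S -> thin S' -> thin (S `|` S').
Proof.
move=> [C [sC [x nCx] lC]] [C' [sC' [x' nCx'] lC']].
exists (C `|` C'); split; first exact: setUSS.
  have finx' := line_closed_finite x lC' nCx'.
  have finx : finite_set [set t : R | C (x + t *: (x' - x))].
    by case: (lC x (x' - x)) => // /(_ 0); rewrite scale0r addr0.
  apply: contrapT => noz; have := @infinite_real R; apply.
  have : finite_set ([set t : R | C (x + t *: (x' - x))] `|`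
    [set t : R | C' (x + t *: (x' - x))]) by rewrite finite_setU.
  apply: sub_finite_set => t _.
  by apply: contrapT => nt; apply: noz; exists (x + t *: (x' - x)).
move=> y d; case: (lC y d) => [Cl|f1]; first by left=> t; left.
case: (lC' y d) => [Cl|f2]; first by left=> t; right.
right; have : finite_set ([set t : R | C (y + t *: d)] `|`
  [set t : R | C' (y + t *: d)]) by rewrite finite_setU.
exact: sub_finite_set.
Qed.

Lemma thin_bigU (I : finType) (S : I -> set V) :
  (forall i, thin (S i)) -> thin [set x | exists i, S i x].
Proof.
move=> thS; apply: (@thin_sub _ (\big[setU/set0]_(i <- enum I) S i)).
  move=> x [i Six]; rewrite -bigcup_seq; exists i => //=.
  by rewrite mem_enum.
by elim/big_ind: _ => //; [exact: thin0|move=> *; exact: thinU].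
Qed.

Lemma affine_linear_line (W : vectType R) (f : V -> W) x d :
  affine_linear f -> exists e, forall t, f (x + t *: d) = f x + t *: e.
Proof.
by move=> [M [b fE]]; exists (M d) => t; rewrite !fE linearD linearZ/= addrAC.
Qed.

Lemma thin_preimage (f : V -> V) S : affine_linear f -> bijective f ->
  thin S -> thin (f @^-1` S).
Proof.
move=> af [g fK gK] [C [sC [x nCx] lC]]; exists (f @^-1` C); split.
- by move=> y /= /sC.
- by exists (g x); rewrite /preimage/= gK.
- move=> y d /=; have [e fl] := affine_linear_line y d af.
  have := lC (f y) e.
  case=> [Cl|fin]; [left=> t|right]; rewrite ?fl//.
  by apply: sub_finite_set fin => t /=; rewrite fl.
Qed.

(** By affine interpolation, two distinct parameters with value in [U] force the whole line into
    [U]. *)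
Lemma thin_affine_preimage (W : vectType R) (f : V -> W) (U : {vspace W}) :
  affine_linear f -> (exists x, f x \notin U) -> thin [set x | f x \in U].
Proof.
move=> af [x0 nfx0]; exists [set x | f x \in U]; split=> //.
  by exists x0; exact/negP.
move=> x d /=; have [e fl] := affine_linear_line x d af.
have [[t [s [neq ft fs]]]|noteq] := pselect (exists t s : R,
    [/\ t != s, f (x + t *: d) \in U & f (x + s *: d) \in U]); [left=> r|right].
  have ts : t - s != 0 by rewrite subr_eq0.
  have -> : f (x + r *: d) = f (x + s *: d) +
      ((r - s) / (t - s)) *: (f (x + t *: d) - f (x + s *: d)).
    rewrite !fl opprD addrACA subrr add0r -scalerBl scalerA divfK//.
    by rewrite -addrA -scalerDl subrKC.
  by rewrite memvD// memvZ// memvB.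
have [[t ft]|noneq] := pselect (exists t : R, f (x + t *: d) \in U).
  apply: sub_finite_set (finite_set1 t) => s /= fs.
  apply/eqP; apply: contrapT => /negP neq.
  by apply: noteq; exists s, t.
by apply: sub_finite_set (finite_set0 R) => t /= ft; case: noneq; exists t.
Qed.

Lemma affine_linearB (W : vectType R) (f g : V -> W) :
  affine_linear f -> affine_linear g -> affine_linear (fun x => f x - g x).
Proof.
move=> [M [b fE]] [N [c gE]]; exists (M - N), (b - c) => x.
by rewrite fE gE add_lfunE opp_lfunE opprD addrACA.
Qed.

Lemma thin_eq_affine (W : vectType R) (f g : V -> W) :
  affine_linear f -> affine_linear g -> f <> g -> thin [set x | f x = g x].
Proof.
move=> af ag neq.
have -> : [set x | f x = g x] = [set x | f x - g x \in 0%VS].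
  by apply/seteqP; split=> x /=; rewrite memv0 subr_eq0 => /eqP.
apply: thin_affine_preimage; first exact: affine_linearB.
apply: contrapT => noneq; apply: neq; apply/funext => x.
apply/eqP; rewrite -subr_eq0 -memv0; apply: contrapT => /negP nx.
by apply: noneq; exists x.
Qed.

End ThinSets.

(** * Continuity along lines and the choice of a single linear piece *)

Section LineContinuity.
Variables (R : realType) (V W : vectType R).
Implicit Types (F f g : V -> W) (x d : V).

Definition line_continuous F :=
  forall x d, wcontinuous (fun t : R => F (x + t *: d)).

Lemma line_continuousD f g : line_continuous f -> line_continuous g ->
  line_continuous (fun x => f x + g x).
Proof. by move=> cf cg x d; exact: wcontinuousD. Qed.

Lemma line_continuous_affine f : affine_linear f -> line_continuous f.
Proof.
move=> af x d phi; have [e fl] := affine_linear_line x d af.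
have -> : (fun t : R => phi (f (x + t *: d)) : R) =
          (fun t => phi (f x) + t * phi e).
  by apply/funext => t; rewrite fl linearD linearZ.
move=> t; apply: cvgD; first exact: cvg_cst.
by apply: cvgM; [exact: cvg_id|exact: cvg_cst].
Qed.

Lemma line_closed_polyhedral (A : set V) x d :
  convex_polyhedral A -> closed [set t : R | A (x + t *: d)].
Proof.
move=> [n [H [hsH ->]]].
have -> : [set t : R | (\bigcap_i H i) (x + t *: d)] =
    \bigcap_i [set t : R | H i (x + t *: d)] by [].
apply: closed_bigI => i _; have [phi [c [_ ->]]] := hsH i.
have -> : [set t : R | [set y | phi y <= c] (x + t *: d)] =
    (fun t : R => phi x + t * phi d : R) @^-1` [set r | r <= c].
  by apply/seteqP; split=> t /=; rewrite linearD linearZ.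
apply: preimage_closed; last exact: closed_le.
move=> t _; apply: cvgD; first exact: cvg_cst.
by apply: cvgM; [exact: cvg_id|exact: cvg_cst].
Qed.

Lemma piecewise_linearP F : piecewise_linear F ->
  exists m (A : 'I_m -> set V) (f : 'I_m -> V -> W),
    [/\ forall i, convex_polyhedral (A i), forall x, exists i, A i x,
        forall i, affine_linear (f i) & forall i x, A i x -> F x = f i x].
Proof.
move=> [m [A [pA covA FA]]].
have [f fP] : {f : 'I_m -> V -> W & forall i, affine_linear (f i) /\
    forall x, A i x -> F x = f i x}.
  apply: (@choice _ _
    (fun i f => affine_linear f /\ forall x, A i x -> F x = f x)) => i.
  have [M [b Fi]] := FA i; exists (fun x => M x + b).
  by split=> //; exists M, b.
exists m, A, f; split=> //; try by move=> i; have [] := fP i.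
by move=> x; have : setT x by []; rewrite -covA => -[i _ Aix]; exists i.
Qed.

Lemma line_continuous_piecewise_linear F :
  piecewise_linear F -> line_continuous F.
Proof.
move=> /piecewise_linearP[m [A [f [pA covA af Ff]]]] x d.
apply: (@wcontinuous_finite_closed_cover _ _ _ _
  (fun i => [set t : R | A i (x + t *: d)]) _ (fun i t => f i (x + t *: d))).
- by move=> i; exact: line_closed_polyhedral.
- by move=> t; exact: covA.
- by move=> i; exact: line_continuous_affine.
- by move=> i t; exact: Ff.
Qed.

(** Join [x] to a point [z] off [C]. This line meets [C] finitely often, so the closed set of
    parameters where [F] agrees with some [f i] is cofinite, hence all of [R]; the parameter 0 gives
    [x]. *)
Lemma thin_extend (I : finType) F (f : I -> V -> W) (S : set V) :
  line_continuous F -> (forall i, line_continuous (f i)) -> thin S ->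
  (forall x, ~ S x -> exists i, F x = f i x) ->
  forall x, exists i, F x = f i x.
Proof.
move=> cF cf [C [sSC [z nCz] lC]] Ff x.
pose B i := [set t : R | F (x + t *: (z - x)) = f i (x + t *: (z - x))].
have BT : \bigcup_i B i = setT.
  apply: cofinite_closed_real.
    apply: closed_bigcup => [|i _].
      exact: finite_finset.
    by apply: wcontinuous_closed_eq; [exact: cF|exact: cf].
  apply: sub_finite_set (line_closed_finite x lC nCz) => t /= nB.
  apply: contrapT => nC; apply: nB.
  have [|i Fi] := Ff (x + t *: (z - x)); first by move=> /sSC.
  by exists i.
have : setT (0 : R) by [].
by rewrite -BT => -[i _]; rewrite /B /= scale0r addr0; exists i.
Qed.

(* Off a thin set, any two points are joined by two segments avoiding all the
   sets [N i = N j], which have codimension at least two; along them the index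
   cannot change. *)
Lemma linear_selection (I : finType) (N : I -> 'Hom(V, W)) F :
  line_continuous F -> (forall x, exists i, F x = N i x) ->
  (forall i j, N i <> N j ->
    forall x, exists z, (N i - N j) z \notin <[(N i - N j) x]>%VS) ->
  exists i, F =1 N i.
Proof.
move=> cF FN rkN.
pose D := {p : I * I | `[< N p.1 <> N p.2 >]}.
pose E (p : D) := N (val p).1 - N (val p).2.
have cN i : affine_linear (N i) by exists (N i), 0 => x; rewrite addr0.
have aE p : affine_linear (E p) by exists (E p), 0 => x; rewrite addr0.
have rkE p x : exists z, E p z \notin <[E p x]>%VS.
  by apply: rkN; exact/asboolP/(valP p).
have eqN i j x : N i x = N j x -> (forall p, E p x <> 0) -> N i = N j.
  move=> eqx nE; apply: contrapT => neq.
  have neqp : `[< N (i, j).1 <> N (i, j).2 >] by exact/asboolP.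
  apply: (nE (exist _ (i, j) neqp)).
  by rewrite /E /= add_lfunE opp_lfunE eqx subrr.
have segment x z : (forall p, E p x <> 0) ->
    (forall p, E p z \notin <[E p x]>%VS) ->
    exists i, F x = N i x /\ F z = N i z.
  move=> nEx nEz; pose l t := x + t *: (z - x).
  (* A zero at [t != 0] would give [E p z = (1 - t^-1) *: E p x], against [nEz]. *)
  have nEl t p : E p (l t) <> 0.
    rewrite /l => /eqP El; have [t0|t0] := eqVneq t 0.
      by move: El; rewrite t0 scale0r addr0 => /eqP; exact: nEx.
    have /negP := nEz p; apply; apply/vlineP; exists (1 - t^-1).
    move: El; rewrite linearD linearZ linearB /= addrC addr_eq0 => /eqP.
    move=> /(congr1 (fun y => t^-1 *: y)).
    rewrite scalerA mulVf// scale1r => /eqP; rewrite subr_eq => /eqP ->.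
    by rewrite scalerN scalerBl scale1r addrC.
  pose B i := [set t | F (l t) = N i (l t)].
  have BT : forall i, B i !=set0 -> B i = setT.
    apply: connected_finite_cover.
    - exact: connected_setT.
    - move=> i; apply: wcontinuous_closed_eq; first exact: cF.
      exact: line_continuous_affine.
    - by move=> t; exact: FN.
    - move=> i j t Bi Bj; rewrite /B (eqN i j (l t))//.
      by rewrite -Bi -Bj.
  have [i Fx] := FN x; exists i; split=> //.
  have Bi0 : B i !=set0 by exists 0; rewrite /B /l /= scale0r addr0.
  have : setT (1 : R) by [].
  by rewrite -(BT _ Bi0) /B /l /= scale1r subrKC.
have thE : thin [set x | exists p, E p x \in 0%VS].
  apply: thin_bigU => p; apply: thin_affine_preimage => //.
  (* At the point 0 the span is trivial, so [rkE] says that [E p] is not the zero map. *)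
  have [z] := rkE p 0; rewrite linear0 => nz; exists z.
  by apply: contra nz; exact/subvP/sub0v.
have nthin S : thin S -> exists x, ~ S x.
  by move=> [C [sC [x nC] _]]; exists x => /sC.
have nE0 x : ~ (exists p, E p x \in 0%VS) -> forall p, E p x <> 0.
  by move=> nx p Ex; apply: nx; exists p; rewrite Ex mem0v.
have [x0 /nE0 x0E] := nthin _ thE.
have [i0 Fx0] := FN x0; exists i0.
(* By [thin_extend] with a one-element index type, it suffices to treat points where no [E p]
   vanishes. *)
suff gen x : ~ (exists p, E p x \in 0%VS) -> F x = N i0 x.
  move=> x; have [] // : exists _ : unit, F x = N i0 x.
  apply: (thin_extend cF (f := fun=> N i0) _ thE).
    by move=> _; exact: line_continuous_affine.
  by move=> y /gen ->; exists tt.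
move=> /nE0 xE.
have thl y : thin [set z | exists p, E p z \in <[E p y]>%VS].
  by apply: thin_bigU => p; apply: thin_affine_preimage.
(* A vertex in general position with respect to both [x0] and [x]: the index is carried from [x0] to
   [z], then from [z] to [x]. *)
have [z nz] := nthin _ (thinU (thl x0) (thl x)).
have z0 y : y = x0 \/ y = x -> forall p, E p z \notin <[E p y]>%VS.
  by move=> [] -> p; apply/negP => Ez; apply: nz; [left|right]; exists p.
have zE p : E p z <> 0.
  by move=> Ez; have := z0 x0 (or_introl erefl) p; rewrite Ez mem0v.
have [i [Fx0i Fzi]] := segment _ _ x0E (z0 _ (or_introl erefl)).
have [j [Fxj Fzj]] := segment _ _ xE (z0 _ (or_intror erefl)).
rewrite (eqN i0 i x0) -?Fx0 -?Fx0i//.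
by rewrite (eqN i j z) -?Fzi -?Fzj.
Qed.

End LineContinuity.

(** * Polyhedra and composition with linear maps *)

Section PiecewiseLinearComposition.
Variable R : realType.

Lemma convex_polyhedral_setT (V : vectType R) : convex_polyhedral [set: V].
Proof.
by exists 0, (fun=> setT); split=> [[]//|]; apply/seteqP; split.
Qed.

Lemma convex_polyhedral_half_space (V : vectType R) (H : set V) :
  closed_half_space H -> convex_polyhedral H.
Proof.
move=> hsH; exists 1%N, (fun=> H); split=> //.
by apply/seteqP; split=> [x Hx i|x /(_ ord0 I)].
Qed.

Lemma convex_polyhedralI (V : vectType R) (A B : set V) :
  convex_polyhedral A -> convex_polyhedral B -> convex_polyhedral (A `&` B).
Proof.
move=> [m [H [hsH ->]]] [n [H' [hsH' ->]]].
exists (m + n)%N,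
  (fun i => match fintype.split i with inl j => H j | inr k => H' k end).
split; first by move=> i; case: fintype.split.
apply/seteqP; split=> [x [Hx H'x] i _|x HH'].
  by case: fintype.split => j; [exact: Hx|exact: H'x].
split=> j _.
  by have := HH' (lshift n j) I; rewrite (unsplitK (inl j)).
by have := HH' (rshift m j) I; rewrite (unsplitK (inr j)).
Qed.

Lemma convex_polyhedral_bigI (V : vectType R) n (A : 'I_n -> set V) :
  (forall i, convex_polyhedral (A i)) -> convex_polyhedral (\bigcap_i A i).
Proof.
move=> pA; rewrite (_ : \bigcap_i _ = \big[setI/setT]_(i < n) A i).
  elim/big_ind: _ => //; first exact: convex_polyhedral_setT.
  exact: convex_polyhedralI.
rewrite -bigcap_seq.
by apply/seteqP; split=> x Ax i _; apply: Ax; rewrite //= mem_index_enum.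
Qed.

Lemma affine_piecewise_linear (V W : vectType R) (f : V -> W) :
  affine_linear f -> piecewise_linear f.
Proof.
move=> [M [b fE]]; exists 1%N, (fun=> setT); split.
- by move=> _; exact: convex_polyhedral_setT.
- by apply/seteqP; split=> // x _; exists ord0.
- by move=> _; exists M, b.
Qed.

(** A functional may pull back to 0, and the preimage of its half-space is then everything or empty.
    Half-spaces require nonzero functionals, so the empty set is polyhedral only when [V'] is
    nonzero. *)
Lemma convex_polyhedral_preimage (V V' : vectType R) (S : 'Hom(V', V)) A :
  \dim {:V'} != 0%N -> convex_polyhedral A -> convex_polyhedral (S @^-1` A).
Proof.
rewrite dimv_eq0 => dV' [n [H [hsH ->]]].
rewrite (_ : S @^-1` _ = \bigcap_i (S @^-1` H i))//.
apply: convex_polyhedral_bigI => i; have [phi [c [_ ->]]] := hsH i.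
have -> : S @^-1` [set x | phi x <= c] = [set x | (phi \o S)%VF x <= c].
  by apply/seteqP; split=> x /=; rewrite comp_lfunE.
have [->|n0] := eqVneq (phi \o S)%VF 0; last first.
  by apply: convex_polyhedral_half_space; exists (phi \o S)%VF, c.
have [c0|c0] := leP 0 c.
  rewrite (_ : mkset _ = setT); first exact: convex_polyhedral_setT.
  by apply/seteqP; split=> // x _ /=; rewrite zero_lfunE.
(* the empty set is cut out by two opposite half-spaces *)
have [v v0] : exists v : V', v != 0.
  by exists (vpick {:V'}); rewrite vpick0.
have [psi psi0] : exists psi : 'Hom(V', R^o), psi != 0.
  apply: contrapT => nopsi; move: v0; rewrite -[v == 0]negbK => /negP; apply.
  apply/negPn/eqP; apply: (@hom_separated R) => phi'; rewrite linear0.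
  suff -> : phi' = 0 by rewrite zero_lfunE.
  by apply/eqP; apply: contrapT => /negP n0; apply: nopsi; exists phi'.
rewrite (_ : mkset _ = [set x | psi x <= -1] `&` [set x | (- psi) x <= -1]).
  apply: convex_polyhedralI; apply: convex_polyhedral_half_space.
    by exists psi, (-1).
  by exists (- psi), (-1); rewrite oppr_eq0.
apply/seteqP; split=> x /=; rewrite ?zero_lfunE; first by rewrite leNgt c0.
move=> [le1 le2]; move: le2; rewrite opp_lfunE lerN2 => le2.
by have := le_trans le2 le1; rewrite leNgt (lt_trans (ltrN10 R) ltr01).
Qed.

Lemma piecewise_linear_comp (V V' W W' : vectType R) (S : 'Hom(V', V))
    (T : 'Hom(W, W')) (B : 'Hom(V', W')) (f : V -> W) :
  piecewise_linear f -> piecewise_linear (fun x => T (f (S x)) + B x).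
Proof.
move=> [m [A [pA covA fA]]].
(* On the zero space a preimage of a piece may be empty, hence not polyhedral, but every map is
   constant there. *)
have [d0|d0] := eqVneq (\dim {:V'}) 0%N.
  apply: affine_piecewise_linear; exists 0, (T (f 0)) => x.
  move/eqP: d0; rewrite dimv_eq0 => /eqP d0.
  have -> : x = 0 by apply/eqP; rewrite -memv0 -d0 memvf.
  by rewrite !linear0 addr0 add0r.
exists m, (fun i => S @^-1` A i); split.
- by move=> i; exact: convex_polyhedral_preimage.
- by rewrite -preimage_bigcup covA preimage_setT.
- move=> i; have [M [b fE]] := fA i.
  exists (T \o M \o S + B)%VF, (T b) => x Ax.
  by rewrite fE// add_lfunE !comp_lfunE linearD addrAC.
Qed.

End PiecewiseLinearComposition.

(** * Orthogonal complements *)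

Section OrthogonalDecomposition.
Variables (R : realType) (V : vectType R) (dot : {dot V for @idfun R}).
Implicit Types (U : {vspace V}) (u v : V).

Lemma dot_eq0 v : dot v v = 0 -> v = 0.
Proof.
move=> v0; apply/eqP; apply: contraTT isT => n0.
by have := @neq0_dnorm_gt0 _ _ _ dot v n0; rewrite v0 ltxx.
Qed.

Lemma cap_orthov U : (U :&: orthov dot U = 0)%VS.
Proof.
apply/eqP; rewrite -subv0; apply/subvP => v /memv_capP[vU /mem_orthovP vO].
by rewrite memv0; apply/eqP/dot_eq0/vO.
Qed.

(** Gram-Schmidt by induction on the dimension: split off a vector [e] of [U] and recurse on its
    orthogonal complement [U'] in [U]. *)
Lemma orthogonal_decomposition U v :
  exists2 u, u \in U & v - u \in orthov dot U.
Proof.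
have [n] := ubnP (\dim U); elim: n => // n IHn in U v *; rewrite ltnS => dimU.
have [->|U0] := eqVneq U 0%VS.
  by exists 0; rewrite ?mem0v// orthov0 memvf.
pose e := vpick U; have eU : e \in U by exact: memv_pick.
have ee0 : dot e e != 0.
  by apply: contra U0 => /eqP/dot_eq0/eqP; rewrite vpick0.
pose U' := (U :&: orthov dot <[e]>)%VS.
have dimU' : (\dim U' < \dim U)%N.
  rewrite (ltn_leqif (dimv_leqif_sup (capvSl _ _))).
  apply/negP => /subvP/(_ e eU)/memv_capP[_].
  by rewrite mem_orthov1; exact/negP.
pose c := dot v e / dot e e.
have [u' /memv_capP[u'U]] := IHn U' (v - c *: e) (leq_trans dimU' dimU).
rewrite mem_orthov1 => /eqP u'e /mem_orthovP vO.
exists (c *: e + u'); first by rewrite memvD// memvZ.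
have oe : dot (v - (c *: e + u')) e = 0.
  by rewrite linearBl linearDl linearZl_LR /= u'e addr0 divfK// subrr.
(* [w] is [b *: e] plus a vector of [U']; the remainder is orthogonal to the former by [oe] and to
   the latter by [vO]. *)
apply/mem_orthovP => w wU; pose b := dot w e / dot e e.
have : w - b *: e \in U'.
  rewrite memv_cap memvB ?memvZ//= mem_orthov1 linearBl linearZl_LR /=.
  by rewrite divfK// subrr.
move=> /vO; rewrite -addrA -opprD linearBr linearZr_LR /= oe mulr0 subr0.
by [].
Qed.

Lemma addv_orthov U : (U + orthov dot U = fullv)%VS.
Proof.
apply/eqP; rewrite eqEsubv subvf /=; apply/subvP => v _.
have [u uU vu] := orthogonal_decomposition U v.
by rewrite -(subrKC u v) memv_add.
Qed.

End OrthogonalDecomposition.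

(** * Equivariant piecewise linear maps for a connected group *)

Section Equivariance.
Variables (R : realType) (G : topologicalGroupType).
Hypothesis conG : connected [set: G].

Lemma representationK (L : vectType R) (rho : G -> 'End(L)) g :
  representation rho -> cancel (rho g) (rho g^-1%g).
Proof.
by move=> [rho1 rhoM _] v; rewrite -comp_lfunE -rhoM mulVg rho1 id_lfunE.
Qed.

Lemma representationVK (L : vectType R) (rho : G -> 'End(L)) g :
  representation rho -> cancel (rho g^-1%g) (rho g).
Proof. by move=> r; have := representationK g^-1%g r; rewrite invgK. Qed.

(** The coordinates of [rho g v] are linear in the matrix entries of [rho g], which are
    continuous. *)
Lemma wcontinuous_representation (L : vectType R) (rho : G -> 'End(L)) v :
  representation rho -> wcontinuous (fun g => rho g v).
Proof.
move=> [_ _ rhoC] phi; pose e := vbasis {:L}.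
have be : basis_of {:L} e := vbasisP _.
have -> : (fun g => phi (rho g v) : R) = (fun g => \sum_j
    (\sum_k passmx.rVof e v 0 k * passmx.mxof e e (rho g) k j) * phi e`_j).
  apply/funext => g; rewrite {1}(coord_vbasis (memvf (rho g v))) linear_sum.
  apply: eq_bigr => j _; rewrite linearZ /=; congr (_ * _).
  have := passmx.mul_mxof e e (rho g) (passmx.rVof e v).
  rewrite passmx.rVofK// => /matrixP/(_ 0 j); rewrite mxE => ->.
  by rewrite passmx.coord_rVof.
have rhoij i j : continuous (fun g => passmx.mxof e e (rho g) i j).
  move=> g; apply: (@continuous_comp _ _ _
      (fun g => passmx.mxof e e (rho g)) (fun M => M i j)); first exact: rhoC.
  exact: coord_continuous.
apply: continuous_big => [|j _]; first exact: add_continuous.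
move=> h; apply: cvgM; last exact: cvg_cst.
move: h; apply: continuous_big => [|k _]; first exact: add_continuous.
by move=> h; apply: cvgM; [exact: cvg_cst|exact: rhoij].
Qed.

Section Pieces.
Variables (L K : vectType R).
Variables (rhoL : G -> 'End(L)) (rhoK : G -> 'End(K)).
Hypotheses (repL : representation rhoL) (repK : representation rhoK).

(* The finitely many affine maps agreeing with [F] on a non-thin set are
   permuted by [G], hence fixed, [G] being connected. *)
Lemma equivariant_pieces F : HomGpl rhoL rhoK F ->
  exists (I : finType) (f : I -> L -> K),
    (forall i, affine_linear (f i) /\ equivariant rhoL rhoK (f i)) /\
    forall x, exists i, F x = f i x.
Proof.
move=> [eqF plF]; have /piecewise_linearP[m [A [f [pA covA af Ff]]]] := plF.
pose S i := [set x | F x = f i x].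
(* Only the pieces with non-thin coincidence set are kept; the discarded sets have a thin union,
   across which [thin_extend] reaches. *)
exists {i : 'I_m | `[< ~ thin (S i) >]}, (fun i => f (val i)).
split; last first.
  apply: (@thin_extend _ _ _ _ _ _
    [set x | exists i : {i : 'I_m | `[< thin (S i) >]}, S (val i) x]).
  - exact: line_continuous_piecewise_linear.
  - by move=> i; exact: line_continuous_affine.
  - by apply: thin_bigU => i; exact/asboolP/(valP i).
  - move=> x nSx; have [i Aix] := covA x.
    have nthS : `[< ~ thin (S i) >].
      apply/asboolP => thS; apply: nSx.
      have thS' : `[< thin (S i) >] by exact/asboolP.
      by exists (exist _ i thS'); exact: Ff.
    by exists (exist _ i nthS); exact: Ff.
move=> [i /= /asboolP nthS]; split=> //.
(* The group elements that carry [f i] to [f j], for [j] among all the pieces, kept or not. *)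
pose B j := [set g | forall x, rhoK g (f i x) = f j (rhoL g x)].
have BT : forall j, B j !=set0 -> B j = setT.
  apply: connected_finite_cover => //.
  - move=> j; rewrite (_ : B j =
      \bigcap_x [set g | rhoK g (f i x) = f j (rhoL g x)]); last first.
      by apply/seteqP; split=> g Bg x; [move=> _; exact: Bg|exact: Bg].
    apply: closed_bigI => x _; apply: wcontinuous_closed_eq.
      exact: wcontinuous_representation.
    have [M [b fE]] := af j; under eq_fun do rewrite fE.
    apply: wcontinuousD; last exact: wcontinuous_cst.
    exact/wcontinuous_lfun/wcontinuous_representation.
  - move=> g; pose h x := rhoK g (f i (rhoL g^-1%g x)).
    have ah : affine_linear h.
      have [M [b fE]] := af i.
      exists (rhoK g \o M \o rhoL g^-1%g)%VF, (rhoK g b).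
      by move=> x; rewrite /h fE linearD !comp_lfunE.
    (* On the image of [S i] under [rhoL g], [h] agrees with [F] and so with some [f j]. If [h] were
       none of the [f j], these agreements would be thin, and so would [S i]. *)
    have [j hj] : exists j, h = f j.
      apply: contrapT => nh; apply: nthS.
      have th : thin [set x | exists j, h x = f j x].
        apply: thin_bigU => j; apply: thin_eq_affine => // hj.
        by apply: nh; exists j.
      apply: (@thin_sub _ _ _ (rhoL g @^-1` [set x | exists j, h x = f j x])).
        move=> x /= Fx; have [j Aj] := covA (rhoL g x); exists j.
        by rewrite /h representationK// -Fx eqF; exact: Ff.
      apply: thin_preimage => //.
        by exists (rhoL g), 0 => x; rewrite addr0.
      exists (rhoL g^-1%g); [exact: representationK|exact: representationVK].
    by exists j => x; rewrite -hj /h representationK.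
  - move=> j k g Bj Bk; rewrite /B; suff -> : f j = f k by [].
    apply/funext => x; rewrite -(representationVK g repL x).
    by rewrite -Bj -Bk.
(* The identity carries [f i] to itself, so [B i] is the whole group, which is the equivariance of
   [f i]. *)
have B1 : B i !=set0.
  exists 1%g => x; case: repL => -> _ _; case: repK => -> _ _.
  by rewrite !id_lfunE.
by move=> g x; have : setT g by []; rewrite -(BT _ B1); exact.
Qed.

Lemma equivariant_fixed Phi v : equivariant rhoL rhoK Phi ->
  v \in fixed_space rhoL -> Phi v \in fixed_space rhoK.
Proof.
move=> eqPhi /mem_fixed_space fv; apply/mem_fixed_space => g.
by rewrite eqPhi fv.
Qed.

Variables (dotL : {dot L for @idfun R}) (dotK : {dot K for @idfun R}).
Hypotheses (invL : invariant_form rhoL dotL) (invK : invariant_form rhoK dotK).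
Let LG := fixed_space rhoL.
Let KG := fixed_space rhoK.
Let LGp := orthov dotL LG.
Let KGp := orthov dotK KG.

(* [w] is orthogonal to the orthogonal complement of [ker <M -, k>], which
   consists of fixed vectors. *)
Lemma equivariant_orthov (M : 'Hom(L, K)) w : equivariant rhoL rhoK M ->
  w \in LGp -> M w \in KGp.
Proof.
move=> eqM wO; apply/mem_orthovP => k /mem_fixed_space kG.
pose phi := (linfun (applyr dotK k : K -> R^o) \o M)%VF.
have phiE x : phi x = dotK (M x) k by rewrite comp_lfunE lfunE.
have phiG g x : phi (rhoL g x) = phi x.
  by rewrite !phiE -eqM -{1}(kG g) invK.
have [z zK wz] := orthogonal_decomposition dotL (lker phi) w.
have wzG : w - z \in LG.
  apply/mem_fixed_space => g; apply/eqP; rewrite -subr_eq0; apply/eqP.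
  apply: (@dot_eq0 _ _ dotL); move: (w - z) wz => y wz.
  (* [phi] is invariant, so [rhoL g x - x] lies in its kernel; for [x := y] this makes
     [rhoL g y - y] orthogonal to itself. *)
  have yO x : dotL (rhoL g y) (rhoL g x - x) = 0.
    have <- := invL g^-1%g (rhoL g y) (rhoL g x - x).
    rewrite linearB /= !(representationK _ repL).
    have /mem_orthovP := wz; apply; rewrite memv_ker linearB /= phiG subrr//.
  have yO' x : dotL y (rhoL g x - x) = 0.
    by have /mem_orthovP := wz; apply; rewrite memv_ker linearB /= phiG subrr.
  by rewrite linearBl /= yO yO' subrr.
suff -> : w = z.
  by apply: etrans (esym (phiE z)) _; apply/eqP; rewrite -memv_ker.
(* [w - z] is orthogonal to [w], being fixed, and to [z], which lies in the kernel. *)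
apply/eqP; rewrite -subr_eq0; apply/eqP/(@dot_eq0 _ _ dotL).
rewrite [X in X = _]linearBl /=.
have /mem_orthovP -> // := wO.
rewrite sub0r; apply/eqP; rewrite oppr_eq0 herm_eq0C; apply/eqP.
by have /mem_orthovP := wz; apply.
Qed.

(** Equivariance at 0 shows that [b] is fixed, so it cancels. *)
Lemma equivariant_linear_part Phi (M : 'Hom(L, K)) b :
    (forall x, Phi x = M x + b) -> equivariant rhoL rhoK Phi ->
  equivariant rhoL rhoK M.
Proof.
move=> PhiE eqPhi g x; have := eqPhi g x; rewrite !PhiE linearD /=.
have := eqPhi g 0; rewrite linear0 !PhiE linear0 !add0r => ->.
exact: addIr.
Qed.

Lemma equivariant_pl_orthov F v w : HomGpl rhoL rhoK F ->
  v \in LG -> w \in LGp -> F (v + w) - F v \in KGp.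
Proof.
move=> HF vG wO; apply/mem_orthovP => k kG.
have [I [f [fP Ff]]] := equivariant_pieces HF.
pose phi := linfun (applyr dotK k : K -> R^o).
(* [M w] is orthogonal to the fixed vector [k], so after pairing with [k] each piece is constant
   along the line. *)
have phif i t : phi (f i (v + t *: w)) = phi (f i v).
  have [[M [b fE]] eqf] := fP i.
  have eqM := equivariant_linear_part fE eqf.
  have -> : f i (v + t *: w) = f i v + t *: M w.
    by rewrite !fE linearD linearZ /= addrAC.
  rewrite linearD linearZ /=.
  rewrite [X in _ + _ *: X]lfunE /=.
  have /mem_orthovP -> // := equivariant_orthov eqM wO.
  by rewrite scaler0 addr0.
pose B i := [set t : R | phi (F (v + t *: w)) = phi (f i v)].
have [i Fvi] := Ff v.
have BT : B i = setT.
  apply: (@connected_finite_cover _ _ B); first exact: connected_setT.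
  - move=> j; apply: (@wcontinuous_closed_eq _ _ _ _ (fun=> phi (f j v))).
      apply: wcontinuous_lfun; apply: line_continuous_piecewise_linear.
      by case: HF.
    exact: wcontinuous_cst.
  - move=> t; have [j Fj] := Ff (v + t *: w).
    by exists j; rewrite /B /= Fj phif.
  - by move=> j l t; rewrite /B /= => -> ->.
  - by exists 0; rewrite /B /= scale0r addr0 Fvi.
have : setT (1 : R) by []; rewrite -BT /B /= scale1r -Fvi => /eqP.
by rewrite !lfunE /= linearBl /= => /eqP ->; rewrite subrr.
Qed.

(* A rank one equivariant map has a [G]-stable line as its image; as [G] acts
   on it isometrically through a connected subset of [{1, -1}], the line is
   fixed pointwise. *)
Lemma equivariant_rank_gt1 (N : 'Hom(L, K)) : equivariant rhoL rhoK N ->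
  (forall x, N x \in KGp) -> N <> 0 ->
  forall x, exists z, N z \notin <[N x]>%VS.
Proof.
move=> eqN NO N0 x; apply: contrapT => noz.
have Nx z : N z \in <[N x]>%VS by apply/negPn/negP => nz; apply: noz; exists z.
have k0 : N x != 0.
  apply/eqP => Nx0; apply: N0; apply/lfunP => z; rewrite zero_lfunE.
  by apply/eqP; rewrite -memv0; have := Nx z; rewrite Nx0.
have kk0 : dotK (N x) (N x) != 0 by apply: contra k0 => /eqP/dot_eq0/eqP.
pose B (b : bool) := [set g | rhoK g (N x) = (-1) ^+ b *: N x].
have BT : B false = setT.
  apply: connected_finite_cover => //.
  - move=> b; apply: wcontinuous_closed_eq; last exact: wcontinuous_cst.
    exact: wcontinuous_representation.
  - move=> g; have /vlineP[c gk] := Nx (rhoL g x).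
    have : dotK (rhoK g (N x)) (rhoK g (N x)) = dotK (N x) (N x) by exact: invK.
    rewrite eqN gk linearZl_LR linearZr_LR /= mulrA -expr2 => /eqP.
    rewrite -subr_eq0 -{2}[dotK _ _]mul1r -mulrBl mulf_eq0 (negPf kk0) orbF.
    rewrite subr_eq0 sqrf_eq1 => /orP[] /eqP cE.
      by exists false; rewrite /B /= eqN gk cE.
    by exists true; rewrite /B /= eqN gk cE.
  - have Bneq g : B false g -> B true g -> False.
      rewrite /B /= expr0 expr1 scale1r scaleN1r => -> /eqP.
      rewrite -addr_eq0 -mulr2n -scaler_nat scaler_eq0 (negPf k0) orbF.
      by rewrite pnatr_eq0.
    by move=> [] [] g // B1 B2; case: (Bneq g).
  - exists 1%g; rewrite /B /= expr0 scale1r.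
    by case: repK => -> _ _; rewrite id_lfunE.
have kG : N x \in KG.
  apply/mem_fixed_space => g; have : setT g by [].
  by rewrite -BT /B /= expr0 scale1r.
move/negP: k0; apply; rewrite -memv0 -(cap_orthov dotK KG) memv_cap kG.
exact: NO.
Qed.

(** Precomposing the linear parts with the projection [pi] onto [LGp] turns them into maps on all of
    [L], so that one use of [linear_selection] fixes the index for all [v] and [w] at once. *)
Lemma equivariant_pl_decomposition F : HomGpl rhoL rhoK F ->
  exists N : 'Hom(L, K), [/\ equivariant rhoL rhoK N,
    forall w, w \in LGp -> N w \in KGp &
    forall v w, v \in LG -> w \in LGp -> F (v + w) = F v + N w].
Proof.
move=> HF; have [I [f [fP Ff]]] := equivariant_pieces HF.
have [M Mb] : {M : I -> 'Hom(L, K) &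
    forall i, exists b, forall x, f i x = M i x + b}.
  apply: (@choice _ _
    (fun i (M : 'Hom(L, K)) => exists b, forall x, f i x = M x + b)) => i.
  by have [[M [b fE]] _] := fP i; exists M, b.
have eqM i : equivariant rhoL rhoK (M i).
  by have [b fE] := Mb i; apply: equivariant_linear_part fE _; case: (fP i).
pose pi := daddv_pi LGp LG.
have capO : (LGp :&: LG = 0)%VS by rewrite capvC cap_orthov.
have piO x : pi x \in LGp by exact: memv_pi.
have piG x : x - pi x \in LG.
  have {1}<- : pi x + daddv_pi LG LGp x = x.
    by apply: daddv_pi_add; rewrite // addvC addv_orthov memvf.
  by rewrite addrC addKr memv_pi.
have pi_unique v w : v \in LG -> w \in LGp -> pi (v + w) = w.
  move=> vG wO; rewrite linearD /= [pi w]daddv_pi_id//.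
  suff -> : pi v = 0 by rewrite add0r.
  apply/eqP; rewrite -memv0 -capO memv_cap piO /=.
  by rewrite -[pi v](subKr v) memvB.
have invLG := invariant_fixed_space rhoL.
have invLGp : invariant_subspace rhoL LGp by exact: invariant_orthov.
have eqpi g x : pi (rhoL g x) = rhoL g (pi x).
  rewrite -{1}(subrK (pi x) x) linearD /= pi_unique//.
    by have /subvP := invLG g; apply; exact/memv_img.
  by have /subvP := invLGp g; apply; exact/memv_img.
pose N i := (M i \o pi)%VF.
have eqN i : equivariant rhoL rhoK (N i).
  by move=> g x; rewrite !comp_lfunE eqpi eqM.
have NO i x : N i x \in KGp by rewrite comp_lfunE; exact: equivariant_orthov.
pose H x := F x - F (x - pi x).
have HN x : exists i, H x = N i x.
  (* [H x - N i x] is a difference of values of equivariant maps at the fixed vector [x - pi x],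
     hence fixed; it also lies in [KGp], so it vanishes. *)
  have [i Fi] := Ff x; exists i; have [b fE] := Mb i; have [_ eqf] := fP i.
  apply/eqP; rewrite -subr_eq0 -memv0 -(cap_orthov dotK KG) memv_cap.
  apply/andP; split; last first.
    rewrite memvB// /H -{1}(subrK (pi x) x).
    exact: equivariant_pl_orthov.
  have -> : H x - N i x = f i (x - pi x) - F (x - pi x).
    rewrite /H Fi !fE comp_lfunE linearB /= addrAC; congr (_ - _).
    by rewrite addrAC.
  by rewrite memvB// equivariant_fixed//; case: HF.
have lcF : line_continuous F.
  by apply: line_continuous_piecewise_linear; case: HF.
have lcH : line_continuous H.
  apply: line_continuousD => // x d.
  (* [x - pi x] is linear in [x], so this is [- F] along another line. *)
  have -> : (fun t : R => - F (x + t *: d - pi (x + t *: d))) = (fun t =>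
      (- \1)%VF (F ((x - pi x) + t *: (d - pi d)))).
    apply/funext => t; rewrite opp_lfunE id_lfunE linearD linearZ /=.
    by rewrite opprD addrACA scalerBr.
  exact: wcontinuous_lfun.
have rkN i j : N i <> N j ->
    forall x, exists z, (N i - N j) z \notin <[(N i - N j) x]>%VS.
  move=> neq; apply: equivariant_rank_gt1.
  - by move=> g x; rewrite !add_lfunE !opp_lfunE linearB /= !eqN.
  - by move=> x; rewrite add_lfunE opp_lfunE memvB.
  - by move=> /eqP; rewrite subr_eq0 => /eqP.
have [i HNi] := linear_selection lcH HN rkN.
exists (N i); split=> // v w vG wO.
have -> : N i w = N i (v + w) by rewrite !comp_lfunE pi_unique// daddv_pi_id.
by rewrite -HNi /H pi_unique// addrK subrKC.
Qed.

End Pieces.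
End Equivariance.

(** * Irreducible representations *)

Section IrreducibleRepresentations.
Variables (R : realType) (G : topologicalGroupType).

Lemma irreducible_fixed_space (L : vectType R) (rho : G -> 'End(L)) :
  irreducible rho -> nontrivial rho -> fixed_space rho = 0%VS.
Proof.
move=> irr [g gN1]; have [//|fT] := irr _ (invariant_fixed_space rho).
case: gN1; apply/lfunP => v; rewrite id_lfunE.
have : v \in fixed_space rho by rewrite fT memvf.
by move/mem_fixed_space.
Qed.

(** Kernel and image are invariant; as [N] is nonzero, the kernel is zero and the image is
    everything. *)
Lemma schur (L K : vectType R) (rhoL : G -> 'End(L)) (rhoK : G -> 'End(K))
    (N : 'Hom(L, K)) :
  irreducible rhoL -> irreducible rhoK -> equivariant rhoL rhoK N -> N != 0 ->
  bijective N.
Proof.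
move=> irrL irrK eqN N0.
have invker : invariant_subspace rhoL (lker N).
  move=> g; apply/subvP => _ /memv_imgP[v vK ->]; rewrite memv_ker -eqN.
  by move: vK; rewrite memv_ker => /eqP ->; rewrite linear0.
have invimg : invariant_subspace rhoK (limg N).
  move=> g; apply/subvP => _ /memv_imgP[_ /memv_imgP[v _ ->] ->].
  by rewrite eqN memv_img ?memvf.
have ker0 : lker N == 0%VS.
  have [->//|kerT] := irrL _ invker; move/negP: N0; case.
  apply/eqP/lfunP => v; rewrite zero_lfunE; apply/eqP.
  by rewrite -memv_ker kerT memvf.
have imgT : limg N = fullv.
  have [img0|//] := irrK _ invimg; move/negP: N0; case.
  apply/eqP/lfunP => v; rewrite zero_lfunE; apply/eqP.
  by rewrite -memv0 -img0 memv_img ?memvf.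
exists (N^-1)%VF; first exact: lker0_lfunK.
by move=> w; apply: limg_lfunVK; rewrite imgT memvf.
Qed.

(** The line spanned by [b] is invariant, hence all of [K]; the inner product with a multiple of [b]
    reads off the coefficient. *)
Lemma irreducible_fixed_vector (K : vectType R) (dot : {dot K for @idfun R})
    (rho : G -> 'End(K)) (b : K) :
  irreducible rho -> b != 0 -> b \in fixed_space rho ->
  isomorphic rho (@trivial_repr R G).
Proof.
move=> irr b0 /mem_fixed_space bG.
have inv : invariant_subspace rho <[b]>%VS.
  by move=> g; rewrite limg_line bG.
have lineT v : exists c, v = c *: b.
  apply/vlineP; have [/eqP|->] := irr _ inv; last exact: memvf.
  by rewrite -subv0 -memvE memv0 (negPf b0).
have bb0 : dot b b != 0 by apply: contra b0 => /eqP/dot_eq0/eqP.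
pose A := linfun (applyr dot ((dot b b)^-1 *: b) : K -> R^o).
have AE c : A (c *: b) = c.
  by rewrite lfunE /= linearZl_LR linearZr_LR /= mulVf// mulr1.
exists A.
  move=> g v; have [c ->] := lineT v.
  by rewrite /trivial_repr id_lfunE [rho g _]linearZ /= bG.
exists (fun c => c *: b) => //.
by move=> v; have [c ->] := lineT v; rewrite AE.
Qed.

Lemma isomorphic_trivial_fixed (K : vectType R) (rho : G -> 'End(K)) :
  isomorphic rho (@trivial_repr R G) -> forall v, v \in fixed_space rho.
Proof.
move=> [A eqA bijA] v; apply/mem_fixed_space => g; apply: (bij_inj bijA).
by rewrite -eqA /trivial_repr id_lfunE.
Qed.

End IrreducibleRepresentations.

(** * The decomposition, its converse and the irreducible cases *)

Theorem corollary2p8 (R : realType) (G : topologicalGroupType)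
    (L K : vectType R)
    (dotL : {dot L for @idfun R}) (dotK : {dot K for @idfun R})
    (rhoL : G -> 'End(L)) (rhoK : G -> 'End(K)) :
  compact [set: G] -> connected [set: G] ->
  representation rhoL -> representation rhoK ->
  invariant_form rhoL dotL -> invariant_form rhoK dotK ->
  let LG := fixed_space rhoL in
  let KG := fixed_space rhoK in
  let LGp := orthov dotL LG in
  let KGp := orthov dotK KG in
  [/\ forall F, HomGpl rhoL rhoK F ->
        exists! p : (subvs_of LG -> subvs_of KG) *
                    'Hom(subvs_of LGp, subvs_of KGp),
          [/\ piecewise_linear p.1,
              HomG (subrepr rhoL LGp) (subrepr rhoK KGp) p.2 &
              forall (v : subvs_of LG) (w : subvs_of LGp),
                F (vsval v + vsval w) = vsval (p.1 v) + vsval (p.2 w)],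
      forall (psi : subvs_of LG -> subvs_of KG)
             (A : 'Hom(subvs_of LGp, subvs_of KGp)),
        piecewise_linear psi ->
        HomG (subrepr rhoL LGp) (subrepr rhoK KGp) A ->
        exists2 F, HomGpl rhoL rhoK F &
          forall (v : subvs_of LG) (w : subvs_of LGp),
            F (vsval v + vsval w) = vsval (psi v) + vsval (A w),
      irreducible rhoL -> irreducible rhoK -> nontrivial rhoL ->
        (forall F, HomGpl rhoL rhoK F -> affine_linear F) /\
        (HomGpl rhoL rhoK <> [set 0] <->
           isomorphic rhoL rhoK \/ isomorphic rhoK (@trivial_repr R G)) &
      irreducible rhoL -> irreducible rhoK ->
        nontrivial rhoL -> nontrivial rhoK ->
        (HomGpl rhoL rhoK <> [set 0] <-> isomorphic rhoL rhoK)].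
Proof.
move=> _ conG repL repK invL invK LG KG LGp KGp.
have invLGp : invariant_subspace rhoL LGp.
  by apply: invariant_orthov => //; exact: invariant_fixed_space.
have invKGp : invariant_subspace rhoK KGp.
  by apply: invariant_orthov => //; exact: invariant_fixed_space.
have capO : (LGp :&: LG = 0)%VS by rewrite capvC cap_orthov.
pose piO := daddv_pi LGp LG; pose piG := daddv_pi LG LGp.
have decL x : piG x + piO x = x.
  by apply: daddv_pi_add; rewrite ?cap_orthov// addv_orthov memvf.
have piG_unique v w : v \in LG -> w \in LGp -> piG (v + w) = v.
  move=> vG wO; rewrite linearD /= [piG v]daddv_pi_id ?cap_orthov//.
  suff -> : piG w = 0 by rewrite addr0.
  apply/eqP; rewrite -memv0 -capO memv_cap memv_pi andbT.
  by rewrite -[piG w](addrK (piO w)) decL memvB ?memv_pi.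
have piO_unique v w : v \in LG -> w \in LGp -> piO (v + w) = w.
  by move=> vG wO; apply: (addrI (piG (v + w))); rewrite decL piG_unique.
(* Established first, since the case of two non-trivial representations follows from it. *)
have part3 : irreducible rhoL -> irreducible rhoK -> nontrivial rhoL ->
    (forall F, HomGpl rhoL rhoK F -> affine_linear F) /\
    (HomGpl rhoL rhoK <> [set 0] <->
      isomorphic rhoL rhoK \/ isomorphic rhoK (@trivial_repr R G)).
  move=> irrL irrK ntL.
  have LG0 : LG = 0%VS by exact: irreducible_fixed_space.
  have FE F : HomGpl rhoL rhoK F ->
      exists2 N : 'Hom(L, K),
        equivariant rhoL rhoK N & forall x, F x = N x + F 0.
    move=> HF; have [N [eqN _ FN]] :=
      equivariant_pl_decomposition conG repL repK invL invK HF.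
    (* [LG] is zero, so [LGp] is all of [L] and the decomposition at [v = 0] describes [F]. *)
    exists N => // x; rewrite -{1}[x]add0r FN ?mem0v 1?addrC//.
    by rewrite -/LG LG0 orthov0 memvf.
  split=> [F /FE[N _ FN]|]; first by exists N, (F 0).
  split=> [HomN0|].
    have [F HF F0] : exists2 F, HomGpl rhoL rhoK F & F <> 0.
      apply: contrapT => noF; apply: HomN0; apply/seteqP; split=> [F HF|_ ->].
        by apply: contrapT => F0; apply: noF; exists F.
      split; first by move=> g x; rewrite /= linear0.
      apply: affine_piecewise_linear; exists 0, 0 => x.
      by rewrite zero_lfunE addr0.
    have [N eqN FN] := FE _ HF.
    have [N0|N0] := eqVneq N 0; last first.
      by left; exists N => //; exact: (schur irrL irrK eqN).
    (* Here [F] is the nonzero constant [F 0], which is fixed because 0 is. *)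
    right; apply: (@irreducible_fixed_vector _ _ _ dotK _ (F 0)) => //.
      apply/eqP => b0; apply: F0; apply/funext => x.
      by rewrite FN N0 zero_lfunE b0 addr0.
    apply: (@equivariant_fixed _ _ _ _ rhoL); first by case: HF.
    exact: mem0v.
  (* The zero space counts as irreducible; non-triviality excludes it, so that an isomorphism is a
     nonzero map. *)
  have [v v0] : exists v : L, v != 0.
    case: ntL => g gN1; apply: contrapT => nov; apply: gN1; apply/lfunP => v.
    rewrite id_lfunE; have [->|v0] := eqVneq v 0; first by rewrite linear0.
    by case: nov; exists v.
  move=> [[A eqA bijA]|isoK] Hom0.
    have /= HA : HomGpl rhoL rhoK A.
      split=> //; apply: affine_piecewise_linear.
      by exists A, 0 => x; rewrite addr0.
    move: HA; rewrite Hom0 => A0; move/negP: v0; apply; apply/eqP.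
    by apply: (bij_inj bijA); rewrite linear0 A0.
  have KGall := isomorphic_trivial_fixed isoK.
  have [A _ [B AK BK]] := isoK.
  (* The constant map at a nonzero fixed vector of [K]. *)
  have : HomGpl rhoL rhoK (fun=> B 1).
    split; first by move=> g x; have /mem_fixed_space := KGall (B 1); apply.
    apply: affine_piecewise_linear; exists 0, (B 1) => x.
    by rewrite zero_lfunE add0r.
  rewrite Hom0 => /(congr1 (fun h => A (h 0))); rewrite BK /= linear0.
  by move=> /eqP; rewrite oner_eq0.
split=> //; last first.
  move=> irrL irrK ntL ntK; have [_ [H1 H2]] := part3 irrL irrK ntL.
  split=> [/H1[//|isoK]|iso]; last by apply: H2; left.
  case: ntK => g []; apply/lfunP => v; rewrite id_lfunE.
  by have /mem_fixed_space := isomorphic_trivial_fixed isoK v; apply.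
- move=> psi A plpsi eqA.
  pose pG := (linfun (vsproj LG) \o piG)%VF.
  pose pO := (linfun (vsproj LGp) \o piO)%VF.
  have pGE x : vsval (pG x) = piG x.
    by rewrite comp_lfunE lfunE /= vsprojK// memv_pi.
  have pOE x : vsval (pO x) = piO x.
    by rewrite comp_lfunE lfunE /= vsprojK// memv_pi.
  pose iK : 'Hom(subvs_of KG, K) := linfun vsval.
  pose iKp : 'Hom(subvs_of KGp, K) := linfun vsval.
  (* Written with linear maps around [psi] to match [piecewise_linear_comp]. *)
  pose F x := iK (psi (pG x)) + (iKp \o A \o pO)%VF x.
  have FE x : F x = vsval (psi (pG x)) + vsval (A (pO x)).
    by rewrite /F !comp_lfunE !lfunE.
  exists F; last first.
    move=> v w; rewrite FE.
    congr (vsval (psi _) + vsval (A _)); apply: subvs_inj.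
      by rewrite pGE piG_unique ?subvsP.
    by rewrite pOE piO_unique ?subvsP.
  split; last exact: piecewise_linear_comp.
  move=> g x.
  have gG : rhoL g (piG x) = piG x.
    by have /mem_fixed_space : piG x \in LG by exact: memv_pi.
  have gO : rhoL g (piO x) \in LGp.
    by have /subvP := invLGp g; apply; apply/memv_img/memv_pi.
  have gx : rhoL g x = piG x + rhoL g (piO x).
    by rewrite -{1}(decL x) linearD /= gG.
  have -> : F (rhoL g x) =
      vsval (psi (pG x)) + vsval (A (subrepr rhoL LGp g (pO x))).
    rewrite FE; congr (vsval (psi _) + vsval (A _)); apply: subvs_inj.
      by rewrite !pGE gx piG_unique ?memv_pi.
    by rewrite pOE gx piO_unique ?memv_pi// subreprE// pOE.
  rewrite FE linearD /=; congr (_ + _).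
    by have /mem_fixed_space := subvsP (psi (pG x)).
  by rewrite -subreprE// eqA.
- move=> F HF; have [N [eqN NO FN]] :=
    equivariant_pl_decomposition conG repL repK invL invK HF.
  have FG v : v \in LG -> F v \in KG by apply: equivariant_fixed; case: HF.
  pose iL : 'Hom(subvs_of LG, L) := linfun vsval.
  pose iLp : 'Hom(subvs_of LGp, L) := linfun vsval.
  pose psi (v : subvs_of LG) := vsproj KG (F (vsval v)).
  pose A := (linfun (vsproj KGp) \o N \o iLp)%VF.
  have AE w : vsval (A w) = N (vsval w).
    by rewrite !comp_lfunE !lfunE /= vsprojK// NO// subvsP.
  have psiE v : vsval (psi v) = F (vsval v) by rewrite vsprojK// FG// subvsP.
  exists (psi, A); split.
    split=> /=.
    - have := @piecewise_linear_comp _ _ _ _ _ iL (linfun (vsproj KG)) 0 F.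
      move=> /(_ HF.2); congr piecewise_linear; apply/funext => v.
      by rewrite zero_lfunE addr0 !lfunE.
    - by move=> g w; apply: subvs_inj; rewrite subreprE// !AE subreprE// eqN.
    - by move=> v w; rewrite psiE AE FN// subvsP.
  (* Uniqueness: [w = 0] determines [psi], and then [v = 0] determines [A]. *)
  move=> [psi' A'] /= [_ _ FE].
  have psi'E : psi = psi'.
    apply/funext => v; apply: subvs_inj; rewrite psiE.
    by have := FE v 0; rewrite !linear0 !addr0.
  congr (_, _) => //; apply/lfunP => w; apply: subvs_inj; rewrite AE.
  apply: (addrI (vsval (psi 0))); rewrite {2}psi'E -FE psiE FN ?subvsP//.
Qed.
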